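(* (Schauder–Tychonoff) Let $\mathcal K$ be a nonempty compact convex subset of a locally convex quaternionic linear space $\mathcal V$. Then $\mathcal K$ has the fixed point property: for every continuous mapping $T:\mathcal K\to\mathcal K$ there exists $u\in\mathcal K$ such that $u=T(u)$.
   Context: A locally convex quaternionic linear space is a (Hausdorff) topological vector space over the quaternions $\mathbb H$ whose topology has a base of convex neighborhoods of the origin. *)

(* Defs.v *)
From HB Require Import structures.
From mathcomp Require Import all_boot all_order all_algebra.
From mathcomp Require Import ring.
From mathcomp Require Import all_classical all_reals all_analysis.

Set Implicit Arguments.
Unset Strict Implicit.
Unset Printing Implicit Defensive.

Import Order.TTheory GRing.Theory Num.Theory.
Import numFieldNormedType.Exports.

Local Open Scope classical_set_scope.
Local Open Scope ring_scope.

(* [Quat a b c d] is a + b i + c j + d k. *)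
Record quat (R : realType) := Quat { qre : R; qi : R; qj : R; qk : R }.

Section Quaternions.
Variable R : realType.
Implicit Types x y : quat R.

Definition quat_coords x : R * R * R * R := (qre x, qi x, qj x, qk x).

Definition quat_of_coords (t : R * R * R * R) : quat R :=
  let: (a, b, c, d) := t in Quat a b c d.

Lemma quat_coordsK : cancel quat_coords quat_of_coords.
Proof. by case. Qed.

HB.instance Definition _ := Choice.copy (quat R) (can_type quat_coordsK).

Definition quat_zero : quat R := Quat 0 0 0 0.

Definition quat_one : quat R := Quat 1 0 0 0.

Definition quat_opp x : quat R := Quat (- qre x) (- qi x) (- qj x) (- qk x).

Definition quat_add x y : quat R :=
  Quat (qre x + qre y) (qi x + qi y) (qj x + qj y) (qk x + qk y).

(* Bilinear over R, with i^2 = j^2 = k^2 = ijk = -1. *)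
Definition quat_mul x y : quat R :=
  Quat (qre x * qre y - qi x * qi y - qj x * qj y - qk x * qk y)
       (qre x * qi y + qi x * qre y + qj x * qk y - qk x * qj y)
       (qre x * qj y - qi x * qk y + qj x * qre y + qk x * qi y)
       (qre x * qk y + qi x * qj y - qj x * qi y + qk x * qre y).

Let quat_addA : associative quat_add.
Proof. by move=> [? ? ? ?] [? ? ? ?] [? ? ? ?]; congr Quat; rewrite /= addrA. Qed.

Let quat_addC : commutative quat_add.
Proof. by move=> [? ? ? ?] [? ? ? ?]; congr Quat; rewrite /= addrC. Qed.

Let quat_add0 : left_id quat_zero quat_add.
Proof. by move=> [? ? ? ?]; congr Quat; rewrite /= add0r. Qed.

Let quat_addN : left_inverse quat_zero quat_opp quat_add.
Proof. by move=> [? ? ? ?]; congr Quat; rewrite /= addNr. Qed.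

HB.instance Definition _ :=
  GRing.isZmodule.Build (quat R) quat_addA quat_addC quat_add0 quat_addN.

Let quat_mulA : associative quat_mul.
Proof. by move=> [? ? ? ?] [? ? ? ?] [? ? ? ?]; congr Quat => /=; ring. Qed.

Let quat_mul1l : left_id quat_one quat_mul.
Proof. by move=> [? ? ? ?]; congr Quat => /=; ring. Qed.

Let quat_mul1r : right_id quat_one quat_mul.
Proof. by move=> [? ? ? ?]; congr Quat => /=; ring. Qed.

Let quat_mulDl : left_distributive quat_mul +%R.
Proof. by move=> [? ? ? ?] [? ? ? ?] [? ? ? ?]; congr Quat => /=; ring. Qed.

Let quat_mulDr : right_distributive quat_mul +%R.
Proof. by move=> [? ? ? ?] [? ? ? ?] [? ? ? ?]; congr Quat => /=; ring. Qed.

Let quat_one_neq0 : quat_one != 0.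
Proof. by apply/eqP => -[] /eqP; rewrite oner_eq0. Qed.

HB.instance Definition _ := GRing.Zmodule_isNzRing.Build (quat R)
  quat_mulA quat_mul1l quat_mul1r quat_mulDl quat_mulDr quat_one_neq0.

(* The Euclidean topology of R^4. *)
HB.instance Definition _ :=
  Topological.copy (quat R) (initial_topology quat_coords).

Definition quat_real (r : R) : quat R := Quat r 0 0 0.

End Quaternions.

(* A quaternionic linear space, with scalars on the left ([qscale q v] is qv)
   or on the right ([qscale q v] is vq): see [qscaleA].  The library's
   [lmodType (quat R)] cannot be joined with a topology, because the library
   restricts the join of [Topological] and [Lmodule] to ordered scalars. *)
HB.mixin Record Zmodule_isQuatModule (R : realType) V & GRing.Zmodule V := {
  qscale : quat R -> V -> V ;
  qscaleA : (forall p q v, qscale p (qscale q v) = qscale (p * q) v) \/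
            (forall p q v, qscale p (qscale q v) = qscale (q * p) v) ;
  qscale1 : left_id 1 qscale ;
  qscaleDr : right_distributive qscale +%R ;
  qscaleDl : forall v, {morph qscale^~ v : p q / p + q}
}.

#[short(type="quatModType")]
HB.structure Definition QuatModule (R : realType) :=
  {V of GRing.Zmodule V & Zmodule_isQuatModule R V}.

(* Restriction of scalars to R, so that the library's [convex_set] (convexity
   under real coefficients in [0, 1]) makes sense in a quaternionic space. *)
Definition realify (R : realType) (V : quatModType R) : Type := V.

Section Realify.
Variables (R : realType) (V : quatModType R).

HB.instance Definition _ := GRing.Zmodule.on (realify V).

Definition real_scale (r : R) (v : realify V) : realify V :=
  qscale (quat_real r) (v : V).

Let real_scaleA (a b : R) (v : realify V) :
  real_scale a (real_scale b v) = real_scale (a * b) v.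
Proof.
by rewrite /real_scale; case: (@qscaleA R V) => ->; congr (qscale _ _);
  congr Quat => /=; ring.
Qed.

Let real_scale1 : left_id 1 real_scale.
Proof. by move=> v; exact: (@qscale1 R V). Qed.

Let real_scaleDr : right_distributive real_scale +%R.
Proof. by move=> r u v; exact: (@qscaleDr R V). Qed.

Let real_scaleDl (v : realify V) : {morph real_scale^~ v : a b / a + b}.
Proof.
move=> a b; rewrite /real_scale -(@qscaleDl R V); congr (qscale _ _).
by congr Quat => /=; ring.
Qed.

HB.instance Definition _ := GRing.Zmodule_isLmodule.Build R (realify V)
  real_scaleA real_scale1 real_scaleDr real_scaleDl.

End Realify.

Definition quat_convex (R : realType) (V : quatModType R) (A : set V) :=
  @convex_set R (realify V) A.

(* Joined below with [TopologicalZmodule], which provides the continuity of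
   addition and opposite. *)
HB.mixin Record isLocallyConvexQuat (R : realType) V
    & Topological V & QuatModule R V := {
  lcquat_hausdorff : hausdorff_space V ;
  lcquat_scale_continuous :
    continuous (fun z : quat R * V => (qscale z.1 z.2 : V)) ;
  lcquat_locally_convex : exists2 B : set_system V,
    (forall C, B C -> nbhs (0 : V) C /\ quat_convex C) &
    (forall U, nbhs (0 : V) U -> exists2 C, B C & C `<=` U)
}.

#[short(type="lcQuatType")]
HB.structure Definition LocallyConvexQuat (R : realType) :=
  {V of TopologicalZmodule V & QuatModule R V & isLocallyConvexQuat R V}.

(* A mapping K -> K is given by a total map f on X that sends K into K. *)
Definition fixed_point_property (X : topologicalType) (K : set X) :=
  forall f : X -> X, {within K, continuous f} -> set_fun K K f ->
  exists2 u, K u & u = f u.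

(* Main.v *)
Require Import Defs.
From mathcomp Require Import all_boot all_order all_algebra.
From mathcomp Require Import zify lra.

(** Why the theorem holds.

    It suffices to find, for every neighbourhood [U] of 0, a point [x] of [K]
    with [T x - x] in [U] ([approx_fixed_point]): these approximate fixed
    points generate a filter on the compact set [K], a cluster point [u] of
    which satisfies [T u - u = 0] by continuity of [T] and separation.

    For an approximate fixed point, take a convex neighbourhood [C] of 0 with
    [C + C] inside [U], and points [x_0, ..., x_n] of [K] such that every point
    of [K] lies in some [x_i + C].  Writing [y l] for the barycentre of the
    [x_i] with weights [l] in the standard simplex, the sets
    [G_i = {l | T (y l) - x_i in C}] cover the simplex.  The dual form of the
    Knaster-Kuratowski-Mazurkiewicz theorem ([dual_KKM]) gives weights [l] such
    that, for every [i], either [l_i = 0] or [l] is in the closure of [G_i].  In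
    the second case [T (y l) - x_i] is in [C + C], so that the barycentre of
    these differences, which is [T (y l) - y l], is in [C + C] as well.

    The dual KKM theorem is the limit, as [N] tends to infinity, of a statement
    on the grid of the points of the simplex whose coordinates are multiples of
    [1 / N] ([grid_coloring]).  The latter follows from the combinatorial lemma
    of Scarf ([scarf]), an analogue of Sperner's lemma in which the cells of a
    triangulation become the sets that are dominant for a family of linear
    orders, here the orders by each coordinate.  It is proved by the same parity
    argument as Sperner's lemma: for [n] orders, a dominant set of [n] elements
    is a room, its subsets of [n - 1] elements are its doors, and every door
    leads to an even number of rooms, but for the door to the outside. *)

Set Implicit Arguments.
Unset Strict Implicit.
Unset Printing Implicit Defensive.

(** * Scarf's lemma on dominant sets *)

Lemma even_sum (J : finType) (P : pred J) (F : J -> nat) :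
  (forall j, P j -> ~~ odd (F j)) -> ~~ odd (\sum_(j | P j) F j).
Proof.
move=> evF; elim/big_ind: _ => // x y; rewrite oddD.
by move=> /negbTE-> /negbTE->.
Qed.

Section Dominance.
Variables (I T : finType) (r : I -> T -> nat).
Hypothesis r_inj : forall i, injective (r i).
Implicit Types (S : {set T}) (i : I) (y z : T).

(** Scarf's notion, with the total order of each index [i] encoded by an
    injective ranking [r i].  Dominant sets play the part of the cells, of any
    dimension, of a triangulation. *)
Definition dominant S := [forall y, exists i, [forall s in S, r i y <= r i s]].

Lemma dominantP S :
  reflect (forall y, exists i, forall s, s \in S -> r i y <= r i s) (dominant S).
Proof.
apply: (iffP forallP) => dS y.
  by have /existsP[i /forall_inP] := dS y; exists i.
by have [i di] := dS y; apply/existsP; exists i; apply/forall_inP.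
Qed.

Lemma ranking_eq i y z : r i y <= r i z -> r i z <= r i y -> y = z.
Proof. by move=> yz zy; apply: (@r_inj i); apply/eqP; rewrite eqn_leq yz. Qed.

(** A door [S] that is not made of slack elements separates two rooms, or none.
    Map each index to the minimum of [S] for its order.  If [S] is dominant,
    this map is onto [S], which has one element fewer than there are indices, so
    that exactly two indices [i1] and [i2] share their minimum.  A room is
    obtained by adding the largest element, for [i1] or for [i2], among those
    above the minima of [S] for all the other orders.  The slack elements serve
    to make these sets of candidates nonempty. *)
Lemma card_rooms_even S t (slack : I -> T) :
  #|S|.+1 = #|I| -> t \in S ->
  (forall i k, i != k -> r k t < r k (slack i)) ->
  ~~ odd #|[set y | (y \notin S) && dominant (y |: S)]|.
Proof.
move=> cardS tS slack_t.
pose m i := [arg min_(s < t in S) r i s].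
have mS i : m i \in S by rewrite /m; case: arg_minnP.
have m_le i s : s \in S -> r i (m i) <= r i s.
  by rewrite /m; case: arg_minnP => // u _; apply.
have m_eq i s : s \in S -> (forall u, u \in S -> r i s <= r i u) -> s = m i.
  by move=> sS s_le; apply: (@ranking_eq i); [exact: s_le | exact: m_le].
have [/dominantP domS|ndomS] := boolP (dominant S); last first.
  rewrite (_ : [set _ | _] = set0) ?cards0 //; apply/setP => y; rewrite !inE.
  apply/negbTE; rewrite negb_and negbK; apply/orP; right.
  apply: contra ndomS => /dominantP dyS; apply/dominantP => z.
  by have [i zi] := dyS z; exists i => s sS; apply: zi; rewrite !inE sS orbT.
have [i1 [i2 [i12 m12]]] : exists i1 i2, i1 != i2 /\ m i1 = m i2.
  have : ~~ injectiveb m.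
    apply/negP => /injectiveP /card_imset => /(_ I) cm.
    have : #|[set m i | i in I]| <= #|S|.
      by apply/subset_leq_card/subsetP => _ /imsetP[i _ ->].
    by rewrite cm -cardS ltnn.
  by case/injectivePn => i [j ij mij]; exists i, j.
pose above i := [set y | [forall k, (k != i) ==> (r k (m k) < r k y)]].
have aboveP i y : reflect (forall k, k != i -> r k (m k) < r k y) (y \in above i).
  rewrite inE; apply: (iffP forallP) => h k; first exact/implyP/h.
  by apply/implyP/h.
have above_slack i : slack i \in above i.
  apply/aboveP => k ki; apply: leq_ltn_trans (m_le k t tS) _.
  by apply: slack_t; rewrite eq_sym.
pose top i := [arg max_(y > slack i in above i) r i y].
have topA i : top i \in above i by rewrite /top; case: arg_maxnP.
have top_le i z : z \in above i -> r i z <= r i (top i).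
  by rewrite /top; case: arg_maxnP => // u _; apply.
(* In a room, distinct elements are minima for distinct indices.  Since [y] is
   the minimum for some [i], each element of [S] is so for another index.  If
   [i] were neither [i1] nor [i2], or if [y] were below the minimum of [S] for
   one more index, too few indices would remain. *)
have room_above y : y \notin S -> dominant (y |: S) ->
    exists2 i, i \in [set i1; i2] & y = top i.
  move=> yS /dominantP dyS.
  have [i yi] := dyS y.
  have imS (A : {set I}) : (forall s, s \in S -> exists2 l, l \in A &
      forall u, u \in S -> r l s <= r l u) -> #|S| <= #|[set m l | l in A]|.
    move=> h; apply/subset_leq_card/subsetP => s sS.
    by have [l lA ls] := h s sS; apply/imsetP; exists l => //; exact: m_eq.
  have own s : s \in S -> exists2 l, l \in [set~ i] &
      forall u, u \in y |: S -> r l s <= r l u.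
    move=> sS; have [l ls] := dyS s; exists l => //; rewrite !inE.
    apply: contraNneq yS => li; suff -> : y = s by [].
    apply: (@ranking_eq i); last by rewrite -li; apply: ls; rewrite setU11.
    by apply: yi; rewrite !inE sS orbT.
  have cardCi : #|[set~ i]| = #|S| by rewrite cardsC1 -cardS.
  have yA : y \in above i.
    apply/aboveP => k ki; rewrite ltnNge; apply/negP => yk.
    have := imS ([set~ i] :\ k); rewrite leqNgt => /(_ _)/negP; apply.
      move=> s sS; have [l lA ls] := own s sS; exists l => [|u uS].
        rewrite in_setD1 lA andbT; apply: contraNneq yS => lk.
        suff -> : y = s by [].
        apply: (@ranking_eq k); last by rewrite -lk; apply: ls; rewrite setU11.
        exact: leq_trans yk (m_le _ _ sS).
      by apply: ls; rewrite !inE uS orbT.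
    apply: leq_ltn_trans (leq_imset_card _ _) _.
    by rewrite -cardCi [X in _ < X](cardsD1 k) !inE ki.
  have i_i12 : i \in [set i1; i2].
    apply/negPn/negP; rewrite !inE negb_or => /andP[ii1 ii2].
    have : #|[set m l | l in [set~ i]]| == #|[set~ i]|.
      rewrite eqn_leq leq_imset_card cardCi; apply: imS => s /own[l lA ls].
      by exists l => // u uS; apply: ls; rewrite !inE uS orbT.
    move=> /imset_injP /(_ i1 i2); rewrite !inE (eq_sym i1) (eq_sym i2).
    by move=> /(_ ii1 ii2 m12)/eqP; rewrite (negbTE i12).
  exists i => //; apply: (@ranking_eq i); first exact: top_le.
  have [l zl] := dyS (top i).
  have [li|li] := eqVneq l i.
    by move: zl; rewrite li; apply; rewrite setU11.
  have := topA i => /aboveP/(_ l li); rewrite ltnNge zl //.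
  by rewrite !inE mS orbT.
have top_room i : i \in [set i1; i2] ->
    (top i \notin S) && dominant (top i |: S).
  move=> ii12.
  have [j ji mji] : exists2 j, j != i & m j = m i.
    move: ii12; rewrite !inE => /orP[]/eqP->; last by exists i1.
    by exists i2; rewrite // eq_sym.
  have /aboveP tA := topA i.
  apply/andP; split.
    apply/negP => tS'; have [l lt] := domS (top i).
    have tE := m_eq _ _ tS' lt.
    have [li|li] := eqVneq l i; last by have := tA l li; rewrite -tE ltnn.
    by have := tA j ji; rewrite mji tE li ltnn.
  apply/dominantP => z.
  have [zA|] := boolP (z \in above i).
    exists i => s; rewrite !inE => /orP[/eqP->|sS]; first exact: top_le.
    have [l lz] := domS z.
    have [<-|li] := eqVneq l i; first exact: lz.
    by have /aboveP/(_ l li) := zA; rewrite ltnNge lz.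
  move=> /aboveP zA.
  have [k ki zk] : exists2 k, k != i & r k z <= r k (m k).
    have [k /andP[ki zk]|h] := pickP (fun k => (k != i) && (r k z <= r k (m k))).
      by exists k.
    exfalso; apply: zA => k ki; have := h k; rewrite ki /= => /negbT.
    by rewrite -ltnNge.
  exists k => s; rewrite !inE => /orP[/eqP->|sS].
    exact: leq_trans zk (ltnW (tA k ki)).
  exact: leq_trans zk (m_le _ _ sS).
have top12 : top i1 != top i2.
  apply/eqP => t12; have [l lt] := domS (top i1).
  have [li|li] := eqVneq l i1; last first.
    by have /aboveP/(_ l li) := topA i1; rewrite ltnNge lt.
  have li2 : l != i2 by rewrite li.
  by have /aboveP/(_ l li2) := topA i2; rewrite ltnNge -t12 lt.
rewrite (_ : [set _ | _] = [set top i1; top i2]) ?cards2 ?top12 //.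
apply/setP => y; rewrite inE; apply/idP/idP.
  case/andP => yS /(room_above _ yS)[i]; rewrite !inE.
  by move=> /orP[]/eqP-> ->; rewrite eqxx ?orbT.
by rewrite !inE => /orP[]/eqP->; apply: top_room; rewrite !inE eqxx ?orbT.
Qed.

(** The door to the outside: all the slack elements but that of [i0].  As each
    slack element is the least one for its own order, only the order of [i0]
    matters, and the only room is obtained by adding the largest element for
    that order. *)
Lemma card_rooms_slack (slack : I -> T) i0 :
  injective slack ->
  (forall i y, r i (slack i) <= r i y) ->
  (forall i k y, i != k -> (forall j, y != slack j) -> r k y < r k (slack i)) ->
  #|[set y | (y \notin slack @: [set~ i0]) &&
             dominant (y |: slack @: [set~ i0])]| = 1.
Proof.
move=> slack_inj slack_le slack_max; set S := slack @: _.
have slackS k : k != i0 -> slack k \in S.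
  by move=> ki; apply: imset_f; rewrite !inE.
have s0S : slack i0 \notin S.
  by apply/imsetP => -[k]; rewrite !inE => ki /slack_inj ik; rewrite ik eqxx in ki.
pose y0 := [arg max_(y > slack i0 in ~: S) r i0 y].
have [y0S y0_max] : y0 \notin S /\ forall z, z \notin S -> r i0 z <= r i0 y0.
  rewrite /y0; case: arg_maxnP => [|y yS y_max]; first by rewrite inE.
  by split=> [|z zS]; [rewrite inE in yS | apply: y_max; rewrite inE].
rewrite -(cards1 y0); congr #|pred_of_set _|; apply/setP => y; rewrite !inE.
apply/andP/eqP => [[yS /dominantP dyS]|->].
  apply: (@ranking_eq i0); first exact: y0_max.
  have [l y0l] := dyS y0.
  have [li|li] := eqVneq l i0; first by rewrite -li; apply: y0l; rewrite setU11.
  have y0E : y0 = slack l.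
    apply: (@ranking_eq l); last exact: slack_le.
    by apply: y0l; rewrite inE slackS ?orbT.
  by rewrite y0E slackS in y0S.
split=> //; apply/dominantP => z.
have [zS|zS] := boolP (z \in S).
  by have /imsetP[k _ ->] := zS; exists k => s _; exact: slack_le.
exists i0 => s; rewrite !inE => /orP[/eqP->|]; first exact: y0_max.
case/imsetP => k; rewrite !inE => ki ->.
have [->|z0] := eqVneq z (slack i0); first exact: slack_le.
apply/ltnW/slack_max => // j; have [->//|ji] := eqVneq j i0.
by apply: contraNneq zS => ->; exact: slackS.
Qed.

End Dominance.

Section Scarf.
Variables (I T : finType) (r : I -> T -> nat) (slack : I -> T) (c : T -> I).
Hypothesis r_inj : forall i, injective (r i).
Hypothesis slack_min : forall i y, r i (slack i) <= r i y.
Hypothesis slack_max : forall i k y,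
  i != k -> (forall j, y != slack j) -> r k y < r k (slack i).
Hypothesis c_slack : cancel slack c.

(** Sperner's count.  A set with as many elements as there are colors and all
    the colors has one subset that misses the color [i0] only.  Otherwise, a
    subset of that kind comes from an element whose color occurs twice in [R],
    and removing the other element of that color gives a second one. *)
Lemma card_doors_odd (R : {set T}) i0 : #|R| = #|I| ->
  odd #|[set x in R | c @: (R :\ x) == [set~ i0]]| = (c @: R == setT).
Proof.
move=> cardR.
have cardRx x : x \in R -> (#|R :\ x|).+1 = #|I|.
  by move=> xR; rewrite -cardR [RHS](cardsD1 x) xR.
have cRE x : x \in R -> c @: R = c x |: c @: (R :\ x).
  by move=> xR; rewrite -[in LHS](setD1K xR) imsetU1.
have [cR|ncR] := eqVneq (c @: R) setT.
  have c_inj : {in R &, injective c}.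
    by apply/imset_injP; rewrite cR cardsT cardR.
  have /imsetP[x xR cx] : i0 \in c @: R by rewrite cR.
  rewrite (_ : [set _ in _ | _] = [set x]) ?cards1 //.
  apply/setP => y; rewrite !inE; apply/andP/eqP => [[yR /eqP cRy]|->].
    have : i0 \in c @: R by rewrite cR.
    by rewrite (cRE y yR) cRy !inE eqxx orbF cx => /eqP cxy; apply: c_inj.
  split=> //; apply/eqP/setP => i; rewrite !inE.
  apply/imsetP/idP => [[z]|].
    rewrite !inE => /andP[zx zR] ->; apply: contraNneq zx; rewrite cx => czx.
    by apply/eqP; apply: c_inj.
  move=> ii; have /imsetP[z zR iz] : i \in c @: R by rewrite cR.
  exists z => //; rewrite !inE zR andbT; apply: contraNneq ii => zx.
  by rewrite iz zx cx.
apply/negbTE; set D := [set _ in _ | _].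
have [->|/set0Pn[x]] := eqVneq D set0; first by rewrite cards0.
rewrite inE => /andP[xR /eqP cRx].
have cx : c x != i0.
  apply: contraNneq ncR => cx; rewrite (cRE x xR) cRx cx.
  by apply/eqP/setP => i; rewrite !inE orbN.
have c_inj : {in R :\ x &, injective c}.
  by apply/imset_injP; rewrite cRx cardsC1 -(cardRx x xR).
have /imsetP[x' x'R cxx'] : c x \in c @: (R :\ x) by rewrite cRx !inE.
have {x'R} [x'x x'R] : x' != x /\ x' \in R by move: x'R; rewrite !inE => /andP[].
suff -> : D = [set x; x'] by rewrite cards2 eq_sym x'x.
apply/setP => y; rewrite !inE; apply/andP/idP => [[yR /eqP cRy]|].
  have [//|yx /=] := eqVneq y x.
  have : c y \in c @: (R :\ y).
    rewrite cRy !inE; have : c y \in c @: (R :\ x).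
      by apply: imset_f; rewrite !inE yx.
    by rewrite cRx !inE.
  case/imsetP => z; rewrite !inE => /andP[zy zR] cyz.
  have [zx|zx] := eqVneq z x; last first.
    have : y = z by apply: c_inj; rewrite ?inE ?yx ?zx.
    by move=> yz; rewrite yz eqxx in zy.
  by apply/eqP; apply: c_inj; rewrite ?inE ?yx ?x'x // cyz zx.
case/orP => /eqP->; split; rewrite ?cRx //; apply/eqP.
have xRx' : x \in R :\ x' by rewrite !inE eq_sym x'x.
have x'Rx : x' \in R :\ x by rewrite !inE x'x.
rewrite -cRx -(setD1K xRx') -[in RHS](setD1K x'Rx) !imsetU1 -cxx'.
by rewrite !setDDl (setUC [set x]).
Qed.

(** The number of pairs of a room and a door in it that shows all the colors but
    [i0] is odd, counted by doors: only the door to the outside contributes an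
    odd number.  Counted by rooms, it has the parity of the number of rooms that
    show all the colors. *)
Theorem scarf (i0 : I) :
  exists R : {set T}, [/\ dominant r R, #|R| = #|I| & c @: R = setT].
Proof.
pose room (R : {set T}) := dominant r R && (#|R| == #|I|).
pose typed (D : {set T}) := c @: D == [set~ i0].
pose N := \sum_(R | room R) #|[set x in R | typed (R :\ x)]|.
have Nodd : odd N.
  have -> : N = \sum_(D | typed D && (#|D|.+1 == #|I|))
       #|[set y | (y \notin D) && dominant r (y |: D)]|.
    transitivity (\sum_(x : T) \sum_(R | room R && ((x \in R) && typed (R :\ x))) 1).
      rewrite (exchange_big_dep room) /=; last by move=> ? ? _ /andP[].
      apply: eq_bigr => R RR; rewrite -sum1_card; apply: eq_bigl => x.
      by rewrite inE RR.
    transitivity (\sum_(x : T) \sum_(D | (typed D && (#|D|.+1 == #|I|)) &&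
       ((x \notin D) && dominant r (x |: D))) 1).
      apply: eq_bigr => x _.
      rewrite (reindex_onto (fun D => x |: D) (fun R => R :\ x)) /=; last first.
        by move=> R /and3P[_ xR _]; rewrite setD1K.
      apply: eq_bigl => D; rewrite /room setU11 /=.
      have [xD|xD] := boolP (x \in D).
        rewrite andbF; apply/negbTE/nandP; right; apply/eqP => DE.
        by have := setD11 x (x |: D); rewrite DE xD.
      by rewrite setU1K // eqxx andbT cardsU1 xD /= andbC andbCA andbA andbAC -!andbA;
        do !bool_congr.
    rewrite (exchange_big_dep (fun D => typed D && (#|D|.+1 == #|I|))) /=;
      last by move=> ? ? _ /andP[].
    apply: eq_bigr => D DD; rewrite -[RHS]sum1_card; apply: eq_bigl => x.
    by rewrite inE DD.
  set S0 := slack @: [set~ i0].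
  have typedS0 : typed S0 && (#|S0|.+1 == #|I|).
    rewrite /typed /S0 -imset_comp (eq_imset _ c_slack) imset_id eqxx.
    rewrite card_imset ?cardsC1; last exact: can_inj c_slack.
    by rewrite andTb (cardD1 i0).
  rewrite (bigD1 S0) //= (card_rooms_slack r_inj i0 (can_inj c_slack)) //.
  rewrite oddD /= even_sum // => D.
  move=> /andP[/andP[/eqP tD /eqP cardD] DS0].
  have [t tD' tslack] : exists2 t, t \in D & forall j, t != slack j.
    have [/forall_inP h|] := boolP [forall s in D, s == slack (c s)]; last first.
      rewrite negb_forall_in => /exists_inP[t tD' tc]; exists t => // j.
      by apply: contraNneq tc => ->; rewrite c_slack.
    exfalso; move/eqP: DS0; apply.
    rewrite /S0 -tD -imset_comp -[LHS]imset_id; apply: eq_in_imset => s sD /=.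
    exact/eqP/h.
  apply: (card_rooms_even r_inj (slack := slack) cardD tD') => i k ik.
  exact: slack_max.
have [R /andP[/andP[dR /eqP cR] /eqP RT]|h] :=
  pickP (fun R => room R && (c @: R == setT)); first by exists R.
suff : ~~ odd N by rewrite Nodd.
apply: even_sum => R RR.
have /andP[_ /eqP cardR] := RR.
by rewrite card_doors_odd //; have := h R; rewrite RR /= => ->.
Qed.

End Scarf.

(** * Colorings of the grid of the simplex *)

Section Grid.
Variables (I : finType) (N : nat).

(** The points of the standard simplex with coordinates in the multiples of
    [1 / N], scaled by [N]. *)
Definition grid := {x : {ffun I -> 'I_N.+1} | \sum_i x i == N}.

Definition grid_coord (x : grid) (i : I) : nat := val x i.

Lemma sum_grid_coord (x : grid) : \sum_i grid_coord x i = N.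
Proof. exact/eqP/(valP x). Qed.

Lemma grid_of_coord (a : I -> nat) :
  \sum_i a i = N -> exists x : grid, grid_coord x =1 a.
Proof.
move=> sa; have aN i : a i < N.+1 by rewrite ltnS -sa (bigD1 i) //= leq_addr.
pose x : {ffun I -> 'I_N.+1} := [ffun i => Ordinal (aN i)].
have xP : \sum_i x i == N.
  by rewrite -[X in _ == X]sa; apply/eqP/eq_bigr => i _; rewrite ffunE.
by exists (exist _ x xP) => i; rewrite /grid_coord /= ffunE.
Qed.

(** Grid points are compared by their coordinate [i], with ties broken by
    enumeration.  The element [inr j], which is below the grid for the order of
    [j] and above it for the others, is the slack element of [j]: in a room, it
    stands for the face where the coordinate [j] vanishes. *)
Definition grid_rank (i : I) (u : grid + I) : nat :=
  match u with
  | inl x => (grid_coord x i * #|{: grid}| + enum_rank x).+1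
  | inr j => if j == i then 0 else (N.+1 * #|{: grid}|).+1 + enum_rank j
  end.

Lemma grid_rank_inl i x y :
  grid_rank i (inl x) <= grid_rank i (inl y) -> grid_coord x i <= grid_coord y i.
Proof.
rewrite /= ltnS; apply: contraTT; rewrite -!ltnNge => yx.
apply: (@leq_trans ((grid_coord y i).+1 * #|{: grid}|)).
  by rewrite mulSn addnC ltn_add2r ltn_ord.
by apply: leq_trans (leq_addr _ _); rewrite leq_mul2r yx orbT.
Qed.

Lemma grid_rank_lt i x j : j != i -> grid_rank i (inl x) < grid_rank i (inr j).
Proof.
move=> /negbTE /= ->; rewrite addSn ltnS.
apply: leq_trans (leq_addr _ _).
apply: (@leq_trans ((grid_coord x i).+1 * #|{: grid}|)).
  by rewrite mulSn addnC ltn_add2r ltn_ord.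
by rewrite leq_mul2r ltn_ord orbT.
Qed.

Lemma grid_rank_inj i : injective (grid_rank i).
Proof.
move=> [x|j] [y|k] //.
- move=> [/(congr1 (modn^~ #|{: grid}|))].
  by rewrite !modnMDl !modn_small // => /val_inj/enum_rank_inj->.
- have [->|ki] := eqVneq k i; first by rewrite /= eqxx.
  by move=> e; have := grid_rank_lt x ki; rewrite e ltnn.
- have [->|ki] := eqVneq j i; first by rewrite /= eqxx.
  by move=> e; have := grid_rank_lt y ki; rewrite e ltnn.
- rewrite /=; case: (eqVneq j i) (eqVneq k i) => [->|_] [->|_] //.
  by move=> /addnI/val_inj/enum_rank_inj->.
Qed.

(** Apply Scarf's lemma to the grid and the slack elements, [inr i] being colored
    [i], and let [a i] be one more than the least [i]-th coordinate in the room,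
    or 0 when [inr i] is in the room.  The [a i] add up to more
    than [N], for otherwise some grid point would lie above all of them and
    contradict dominance.  Since the coordinates of a point of the room add up
    to [N] and are at least [a i - 1], they exceed [a i] by less than [#|I|].
    Hence any two points of the room are close to each other, and close to the
    face of the simplex whose vertices are the colors of its points. *)
Lemma grid_coloring (i0 : I) (c : grid -> I) :
  exists x, forall i, grid_coord x i <= #|I| \/
    exists2 y, c y = i & forall k,
      (grid_coord x k <= grid_coord y k + #|I|) &&
      (grid_coord y k <= grid_coord x k + #|I|).
Proof.
pose c' (u : grid + I) := match u with inl x => c x | inr j => j end.
have [] := @scarf _ _ grid_rank inr c' grid_rank_inj _ _ (fun=> erefl) i0.
- by move=> i y; rewrite /= eqxx.
- by move=> i k [x|j] ik; [move=> _; exact: grid_rank_lt | move=> /(_ j)/eqP].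
move=> R [/dominantP domR _ cR].
have dom_grid y : exists2 i, inr i \notin R &
    forall z, inl z \in R -> grid_coord y i <= grid_coord z i.
  have [i yi] := domR (inl y); exists i => [|z zR].
    by apply/negP => /yi; rewrite /= eqxx.
  exact/grid_rank_inl/yi.
have colored i : inr i \notin R -> exists2 z, inl z \in R & c z = i.
  move=> iR; have /imsetP[[z zR ->|j jR /= ij]] : i \in c' @: R by rewrite cR.
    by exists z.
  by rewrite ij jR in iR.
have sum_delta m : \sum_i (i == i0) * m = m.
  by rewrite (bigD1 i0) //= eqxx mul1n big1 ?addn0 // => i /negbTE->.
have [y0 _] := grid_of_coord (sum_delta N).
have [j0 /colored[x xR _] _] := dom_grid y0.
pose a i := if inr i \in R then 0
  else (grid_coord [arg min_(z < x | inl z \in R) grid_coord z i] i).+1.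
have a_le i z : inl z \in R -> a i <= (grid_coord z i).+1.
  by rewrite /a; case: ifP => // _ zR; case: arg_minnP => // u _; apply.
have a_gt i y : inr i \notin R ->
    (forall z, inl z \in R -> grid_coord y i <= grid_coord z i) ->
    grid_coord y i < a i.
  by rewrite /a => /negbTE-> yi; case: arg_minnP => // u uR _; rewrite ltnS yi.
have suma : N < \sum_i a i.
  rewrite ltnNge; apply/negP => aN.
  have [|y yE] := @grid_of_coord (fun i => a i + (i == i0) * (N - \sum_i a i)).
    by rewrite big_split /= sum_delta subnKC.
  have [i iR yi] := dom_grid y.
  by have := a_gt i y iR yi; rewrite yE ltnNge leq_addr.
have le_a z k : inl z \in R -> grid_coord z k < a k + #|I|.
  move=> zR; have : \sum_i (grid_coord z i).+1 = N + #|I|.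
    under eq_bigr do rewrite -addn1.
    by rewrite big_split /= sum_grid_coord sum1_card.
  have : \sum_(i | i != k) a i <= \sum_(i | i != k) (grid_coord z i).+1.
    by apply: leq_sum => i _; exact: a_le.
  move: suma; rewrite [\sum_i a i](bigD1 k) // [\sum_i _.+1](bigD1 k) //=.
  lia.
exists x => i; have [iR|/colored[y yR cy]] := boolP (inr i \in R).
  by left; have := le_a x i xR; rewrite /a iR => /ltnW.
right; exists y => // k.
have := (le_a x k xR, le_a y k yR, a_le k x xR, a_le k y yR).
by move=> [[[]]]; lia.
Qed.

End Grid.

From mathcomp Require Import all_classical all_reals all_analysis.

Import Order.TTheory GRing.Theory Num.Theory.
Import numFieldNormedType.Exports.

Local Open Scope classical_set_scope.
Local Open Scope ring_scope.

(** * The dual Knaster-Kuratowski-Mazurkiewicz theorem *)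

Lemma continuous_sum (X : topologicalType) (M : TopologicalNmodule.type)
    (J : Type) (s : seq J) (F : J -> X -> M) :
  (forall j, continuous (F j)) -> continuous (fun x => \sum_(j <- s) F j x).
Proof.
move=> cF x; elim: s => [|j s IHs]; rewrite /continuous_at.
  under eq_fun do rewrite big_nil.
  by rewrite big_nil; exact: cvg_cst.
under eq_fun do rewrite big_cons.
rewrite big_cons.
apply: (@continuous_comp _ _ _ (fun x => (F j x, \sum_(i <- s) F i x))
  (fun z : M * M => z.1 + z.2)); last exact: add_continuous.
exact: cvg_pair (cF j x) IHs.
Qed.

Section Simplex.
Variables (R : realType) (n : nat).
Implicit Types (l m : 'rV[R]_n.+1) (i k : 'I_n.+1).

Definition simplex : set 'rV[R]_n.+1 :=
  [set l | (forall i, 0 <= l ord0 i) /\ \sum_i l ord0 i = 1].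

Lemma simplex_le1 l i : simplex l -> l ord0 i <= 1.
Proof.
by move=> [l0 <-]; rewrite (bigD1 i) //= lerDl; apply: sumr_ge0 => k _.
Qed.

Lemma simplex_compact : compact simplex.
Proof.
have cube : compact [set l : 'rV[R]_n.+1 | forall i, `[0, 1]%classic (l ord0 i)].
  apply: (@rV_compact R _ (fun=> `[(0 : R), 1]%classic)) => i.
  exact: segment_compact.
apply: subclosed_compact cube _ => [|l Dl i]; last first.
  by have [l0 _] := Dl; rewrite /= in_itv /= l0 simplex_le1.
rewrite (_ : simplex =
    (\bigcap_(i in setT) (fun l => l ord0 i) @^-1` [set x | 0 <= x]) `&`
    (fun l => \sum_i l ord0 i) @^-1` [set x | x = 1]); last first.
  apply/seteqP; split=> l [l0 l1]; split=> //; first by move=> i _; exact: l0.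
  by move=> i; exact: l0.
apply: closedI.
  apply: closed_bigI => i _; apply: preimage_closed; last exact: closed_ge.
  by move=> l _; exact: coord_continuous.
apply: preimage_closed; last exact: closed_eq.
move=> l _; apply: continuous_sum => i; exact: coord_continuous.
Qed.

(** Color each grid point [x] by some [i] with [G i x].  When [N] is large
    compared to [n / e], discrepancies of [n] units in the grid are smaller than
    [e]. *)
Lemma approx_dual_KKM (G : 'I_n.+1 -> set 'rV[R]_n.+1) (e : R) : 0 < e ->
  (forall l, simplex l -> exists i, G i l) ->
  exists2 l, simplex l & forall i, l ord0 i <= e \/
    exists2 m, (simplex `&` G i) m & ball l e m.
Proof.
move=> e0 Gcover.
pose N := (Num.truncn (n.+2%:R / e)).+1.
have N0 : 0 < N%:R :> R by rewrite ltr0n.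
have Ne : n.+2%:R < N%:R * e by rewrite -ltr_pdivrMr // truncnS_gt.
pose pt (x : grid 'I_n.+1 N) : 'rV[R]_n.+1 := \row_i ((grid_coord x i)%:R / N%:R).
have ptD x : simplex (pt x).
  split=> [i|]; first by rewrite mxE divr_ge0.
  under eq_bigr do rewrite mxE.
  by rewrite -mulr_suml -natr_sum sum_grid_coord divff // gt_eqF.
have [c cG] := choice (fun x => Gcover (pt x) (ptD x)).
have [x xP] := grid_coloring ord0 c.
have pt_le (a b : nat) : (a <= b + #|'I_n.+1|)%N -> a%:R / N%:R < b%:R / N%:R + e.
  move=> ab; rewrite -ltrBlDl -mulrBl ltr_pdivrMr // mulrC.
  apply: le_lt_trans Ne; rewrite lerBlDl -natrD ler_nat.
  by apply: leq_trans ab _; rewrite leq_add2l card_ord.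
exists (pt x) => // i; have [xi|[y cy xy]] := xP i; [left|right].
  by rewrite mxE; have := pt_le _ 0%N xi; rewrite mul0r add0r => /ltW.
exists (pt y); first by split; rewrite -?cy.
split=> // ? k; rewrite (ord1 _) !mxE -ball_normE /= ltr_norml.
have /andP[/pt_le xyk /pt_le yxk] := xy k.
by apply/andP; split; lra.
Qed.

(** A cluster point of the approximate solutions given by [approx_dual_KKM].
    This is the KKM theorem for the closures of the sets [G i], each augmented by
    the face [l_i = 0]; these faces play the part of the boundary condition. *)
Lemma dual_KKM (G : 'I_n.+1 -> set 'rV[R]_n.+1) :
  (forall l, simplex l -> exists i, G i l) ->
  exists2 l, simplex l &
    forall i, l ord0 i = 0 \/ closure (simplex `&` G i) l.
Proof.
move=> Gcover.
pose P (e : R) := [set l | simplex l /\ forall i, l ord0 i <= e \/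
    exists2 m, (simplex `&` G i) m & ball l e m].
have P_ex e : 0 < e -> P e !=set0.
  by move=> /approx_dual_KKM/(_ Gcover)[l Dl lP]; exists l.
have P_mono e e' : e <= e' -> P e `<=` P e'.
  move=> ee' l [Dl lP]; split=> // i; case: (lP i) => [le|[m Gm lm]].
    by left; exact: le_trans le ee'.
  by right; exists m => //; exact: le_ball lm.
pose F := filter_from [set e : R | 0 < e] P.
have FF : ProperFilter F.
  apply: filter_from_proper => [|e /P_ex //].
  apply: filter_from_filter; first by exists 1 => /=; exact: ltr01.
  move=> e e' /= e0 e'0; exists (Num.min e e'); first by rewrite /= lt_min e0.
  by move=> l lP; split; apply: P_mono lP; rewrite ge_min lexx ?orbT.
have FD : F simplex by exists 1 => [/=|l []//]; exact: ltr01.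
have [l [Dl Fl]] := simplex_compact FF FD.
exists l => // i; have [l0|l0] := eqVneq (l ord0 i) 0; first by left.
right; rewrite /closure /= => B.
have {}l0 : 0 < l ord0 i by rewrite lt0r l0; case: Dl => + _; apply.
move=> /nbhs_ballP[e /= e0 eB].
(* With [d < l_i / 2], a point within [d] of [l] has its [i]-th coordinate
   larger than [d]; with [d <= e / 2], two steps of [d] stay within [e]. *)
pose d := Num.min (e / 2) (l ord0 i / 3).
have d0 : 0 < d by rewrite lt_min !divr_gt0.
have de : d <= e / 2 by rewrite ge_min lexx.
have dl : d <= l ord0 i / 3 by rewrite ge_min lexx orbT.
have FPd : F (P d) by exists d.
have [l' [[Dl' /(_ i) l'P] ll']] := Fl _ _ FPd (nbhsx_ballx l d d0).
case: l'P => [l'd|[m GDm l'm]].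
  exfalso; case: ll' => _ /(_ ord0 i); rewrite -ball_normE /= ltr_norml; lra.
exists m; split=> //; apply: eB.
by apply: le_ball (ball_triangle ll' l'm); lra.
Qed.

End Simplex.

(** * Convex combinations *)

Section Convex.
Variables (R : realFieldType) (E : lmodType R) (A : set E).
Hypothesis convA : convex_set (A : set (convex_lmodType E)).

Lemma convex_set2 (p q : R) (x y : E) :
  A x -> A y -> 0 <= p -> 0 <= q -> p + q = 1 -> A (p *: x + q *: y).
Proof.
move=> Ax Ay p0 q0 pq; have p1 : p <= 1 by lra.
have -> : q = 1 - p by lra.
by have := convA (Itv01 p0 p1) (mem_set Ax) (mem_set Ay); rewrite inE.
Qed.

(** The terms of weight zero are left free, because [dual_KKM] gives no
    information about them. *)
Lemma convex_set_sum n (l : 'I_n -> R) (v : 'I_n -> E) :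
  (forall i, 0 <= l i) -> \sum_i l i = 1 -> (forall i, l i != 0 -> A (v i)) ->
  A (\sum_i l i *: v i).
Proof.
elim: n l v => [|n IHn] l v l0.
  by rewrite big_ord0 => /esym/eqP; rewrite oner_eq0.
rewrite !big_ord_recl => l1 Av.
have [l00|l00] := eqVneq (l ord0) 0.
  rewrite l00 scale0r add0r; apply: IHn => // [|i]; last exact: Av.
  by rewrite -l1 l00 add0r.
set t := \sum_(i < n) l (lift ord0 i) in l1.
have [t0|t0] := eqVneq t 0.
  rewrite big1 ?addr0.
    by rewrite (_ : l ord0 = 1) ?scale1r; [exact: Av | rewrite -l1 t0 addr0].
  move=> i _; have /eqP := t0; rewrite psumr_eq0 // => /allP/(_ i).
  by rewrite mem_index_enum => /(_ isT)/eqP->; rewrite scale0r.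
have tp : 0 < t by rewrite lt0r t0 sumr_ge0.
have -> : \sum_(i < n) l (lift ord0 i) *: v (lift ord0 i) =
    t *: \sum_i (t^-1 * l (lift ord0 i)) *: v (lift ord0 i).
  rewrite scaler_sumr; apply: eq_bigr => i _.
  by rewrite scalerA mulrA divff // mul1r.
apply: convex_set2 => //; [exact: Av| |exact: ltW].
apply: IHn => [i||i].
- by rewrite mulr_ge0 // invr_ge0 ltW.
- by rewrite -mulr_sumr mulVf.
- by rewrite mulf_eq0 negb_or => /andP[_ /Av].
Qed.

End Convex.

Lemma lincomb_split (R : pzRingType) (E : lmodType R) (I : finType)
    (w : I -> R) (a x : I -> E) (z : E) : \sum_i w i = 1 ->
  \sum_i w i *: a i + \sum_i w i *: (z - x i - a i) = z - \sum_i w i *: x i.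
Proof.
move=> w1; rewrite -big_split /=.
under eq_bigr do rewrite -scalerDr addrC subrK scalerBr.
by rewrite sumrB -scaler_suml w1 scale1r.
Qed.

(** * Approximate fixed points in a locally convex space *)

Section LocallyConvex.
Variables (R : realType) (V : lcQuatType R).
Implicit Types (U C : set V) (x y z : V).

Let E := realify V.

Lemma quat_real_continuous : continuous (@quat_real R).
Proof.
apply: (@continuous_comp_initial _ R _ (@quat_coords R) (@quat_real R)) => r.
have c0 : (fun=> 0 : R) @ r --> (0 : R) by exact: cvg_cst.
exact: cvg_pair (cvg_pair (cvg_pair (@cvg_id _ (nbhs r)) c0) c0) c0.
Qed.

Lemma lincomb_continuous (X : topologicalType) (I : finType)
    (w : I -> X -> R) (x : I -> V) : (forall i, continuous (w i)) ->
  continuous (fun t => (\sum_i w i t *: (x i : E) : V)).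
Proof.
move=> wcont.
have termC i : continuous (fun t => qscale (quat_real (w i t)) (x i)).
  move=> t.
  apply: (@continuous_comp _ _ _ (fun t => (quat_real (w i t), x i))
    (fun z : quat R * V => qscale z.1 z.2)); last exact: lcquat_scale_continuous.
  have cq : quat_real (w i t') @[t' --> t] --> quat_real (w i t).
    apply: (@continuous_comp _ _ _ (w i) (@quat_real R)); first exact: wcont.
    exact: quat_real_continuous.
  have cx : x i @[_ --> t] --> x i by exact: cvg_cst.
  exact: cvg_pair cq cx.
exact: (@continuous_sum X V I (index_enum I)
  (fun i t => qscale (quat_real (w i t)) (x i)) termC).
Qed.

Lemma nbhs0_subr z C : nbhs 0 C -> nbhs z [set w | C (z - w)].
Proof.
rewrite -(subrr z) => zC.
apply: (@continuous_comp _ _ _ (fun w : V => (z, w)) (fun p : V * V => p.1 - p.2)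
  z _ _ _ zC); last exact: sub_continuous.
have cz : z @[_ --> z] --> z by exact: cvg_cst.
exact: cvg_pair cz cvg_id.
Qed.

Lemma nbhs0_subl z C : nbhs 0 C -> nbhs z [set w | C (w - z)].
Proof.
rewrite -(subrr z) => zC.
apply: (@continuous_comp _ _ _ (fun w : V => (w, z)) (fun p : V * V => p.1 - p.2)
  z _ _ _ zC); last exact: sub_continuous.
have cz : z @[_ --> z] --> z by exact: cvg_cst.
exact: cvg_pair cvg_id cz.
Qed.

Lemma nbhs0_convex_half U : nbhs 0 U -> exists C,
  [/\ nbhs 0 C, quat_convex C & forall a b, C a -> C b -> U (a + b)].
Proof.
move=> U0; have /= := @add_continuous V (0, 0) U; rewrite /= addr0.
move=> /(_ U0)[[A B] /= [A0 B0] AB].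
have [b bP /(_ (A `&` B))] := @lcquat_locally_convex R V.
case; first exact: filterI.
move=> C /bP[C0 Cconv] CAB; exists C; split=> // a a' /CAB[Aa _] /CAB[_ Ba'].
exact: (AB (a, a')).
Qed.

(** If there were no finite net, the sets of points of [K] that are far from all
    the points of a finite sequence would generate a proper filter; a cluster
    point [u] of it is close to some points that are far from [u]. *)
Lemma compact_finite_net (K C : set V) : K !=set0 -> compact K -> nbhs 0 C ->
  exists n (x : 'I_n.+1 -> V), (forall i, K (x i)) /\
    forall y, K y -> exists i, C (y - x i).
Proof.
move=> [x0 Kx0] Kc C0.
pose D := [set s : seq V | forall k, k \in s -> K k].
pose far (s : seq V) := [set y | K y /\ forall k, k \in s -> ~ C (y - k)].
suff [s Ds fars] : exists2 s, D s & far s = set0.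
  exists (size s), (fun i => nth x0 (x0 :: s) i); split=> [i|y Ky].
    have : nth x0 (x0 :: s) i \in x0 :: s by rewrite mem_nth.
    by rewrite inE => /orP[/eqP->|/Ds].
  have [k ks Cyk] : exists2 k, k \in s & C (y - k).
    apply: contrapT => h; suff : far s y by rewrite fars.
    by split=> // k ks Cyk; apply: h; exists k.
  have ksz : (index k s < size s)%N by rewrite index_mem.
  by exists (lift ord0 (Ordinal ksz)); rewrite /= nth_index.
apply: contrapT => nofin.
pose F := filter_from D far.
have FF : ProperFilter F.
  apply: filter_from_proper => [|s Ds]; last first.
    by apply/set0P/eqP => fars; apply: nofin; exists s.
  apply: filter_from_filter; first by exists [::].
  move=> s t Ds Dt; exists (s ++ t) => [k|y [Ky yst]].
    by rewrite mem_cat => /orP[/Ds|/Dt].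
  by split; split=> // k ks; apply: yst; rewrite mem_cat ks ?orbT.
have FK : F K by exists [::] => // y [].
have [u [Ku Fu]] := Kc F FF FK.
have Fu1 : F (far [:: u]) by exists [:: u] => // k; rewrite inE => /eqP->.
have [y [[_ /(_ u)]]] := Fu _ _ Fu1 (nbhs0_subl u C0).
by rewrite inE eqxx => /(_ isT).
Qed.

Lemma approx_fixed_point (K U : set V) (T : V -> V) :
  K !=set0 -> compact K -> quat_convex K ->
  {within K, continuous T} -> set_fun K K T -> nbhs 0 U ->
  exists2 x, K x & U (T x - x).
Proof.
move=> K0 Kc Kconv Tcont TK U0.
have [C [C0 Cconv CU]] := nbhs0_convex_half U0.
have [n [x [Kx xnet]]] := compact_finite_net K0 Kc C0.
pose y (l : 'rV[R]_n.+1) : V := \sum_i l ord0 i *: (x i : E).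
have ycont : continuous y.
  by apply: lincomb_continuous => i; exact: coord_continuous.
have Ky l : simplex l -> K (y l).
  by move=> [l0 l1]; apply: (convex_set_sum Kconv) => // i _; exact: Kx.
have [l Dl lP] := @dual_KKM _ _ (fun i l => C (T (y l) - x i))
  (fun l Dl => xnet _ (TK _ (Ky l Dl))).
have [l0 l1] := Dl.
exists (y l); first exact: Ky.
(* In the second case of [lP], a point [m] of [G i] close to [l] gives
   [a i = T (y m) - x i] in [C], and the remainder [T (y l) - T (y m)] is in [C]
   by continuity. *)
have /choice[a aP] : forall i, exists a : E, l ord0 i != 0 ->
    C a /\ C (T (y l) - x i - a).
  move=> i; have [->|cl] := lP i; first by exists 0; rewrite eqxx.
  have Tnear : nbhs (y l) [set z | K z -> C (T (y l) - T z)].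
    have /subspace_continuousP/(_ _ (Ky _ Dl)) TC := Tcont.
    exact: (TC _ (nbhs0_subr _ C0)).
  have [m [[Dm Cm] /(_ (Ky _ Dm)) Clm]] := cl _ (ycont l _ Tnear).
  exists (T (y m) - x i) => _; split=> //.
  by rewrite opprB addrA subrK.
rewrite -[T (y l) - y l](lincomb_split (E := E) a x (T (y l)) l1).
by apply: CU; apply: convex_set_sum => // i /aP[].
Qed.

End LocallyConvex.

Theorem theorem5p5 (R : realType) (V : lcQuatType R) (K : set V) :
  K !=set0 -> compact K -> quat_convex K -> fixed_point_property K.
Proof.
move=> K0 Kc Kconv T Tcont TK.
pose P (U : set V) := [set x | K x /\ U (T x - x)].
pose F := filter_from (nbhs (0 : V)) P.
have FF : ProperFilter F.
  apply: filter_from_proper => [|U U0]; last first.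
    by have [x Kx Ux] := approx_fixed_point K0 Kc Kconv Tcont TK U0; exists x.
  apply: filter_from_filter; first by exists setT; exact: filterT.
  move=> U W U0 W0; exists (U `&` W); first exact: filterI.
  by move=> x [Kx [Ux Wx]].
have FK : F K by exists setT => [|x []//]; exact: filterT.
have [u [Ku Fu]] := Kc F FF FK.
exists u => //; apply/esym/eqP; rewrite -subr_eq0; apply/eqP.
apply: (@lcquat_hausdorff R V) => A B Au B0.
have Fcl : F (P B) by exists B.
have : nbhs u [set x | K x -> A (T x - x)].
  have /(_ A Au) := @sub_continuous V (T u, u).
  move=> [[A1 A2] /= [A1u A2u] A12].
  have /subspace_continuousP/(_ _ Ku) TC := Tcont.
  have TA1 : nbhs u [set z | K z -> A1 (T z)] by exact: (TC _ A1u).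
  apply: filterS (filterI TA1 A2u) => z [TA1z A2z] Kz.
  by apply: (A12 (T z, z)); split=> //; apply: TA1z.
move=> /(Fu _ _ Fcl)[z [[Kz Bz] /(_ Kz) Az]].
by exists (T z - z).
Qed.
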